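(* Let $n>2$, $\alpha\ge0$, let $v\in h^1(\mathbb{R}^n_+)$ and let $x$ be an arbitrary point in $\mathbb{R}^n_+$. The sharp coefficient $\mathcal{C}_{\alpha,n,1}(x)$ in the inequality $$\left|\nabla\big(x_n^{n\alpha-1}v(x)\big)\right|\le\mathcal{C}_{\alpha,n,1}(x)\,\|v\|_1$$ is given by $$\mathcal{C}_{\alpha,n,1}(x)=C_{\alpha,n,1}\,x_n^{\,n(\alpha-1)-1},$$ where $$C_{\alpha,n,1}=\frac{2n}{\omega_n}|1-\alpha|$$ if $$0\le\alpha\le\frac{\sqrt{n+1}}{\sqrt{n+1}+1}\quad\text{or}\quad\alpha\ge\frac{\sqrt{n+1}}{\sqrt{n+1}-1},\qquad( * )$$ and $$C_{\alpha,n,1}=\frac{2n}{\omega_n}\left(\frac{n}{2\alpha-1}\right)^{n/2}\left(\frac{\alpha^2}{n+1}\right)^{(n+2)/2}$$ if $$\frac{\sqrt{n+1}}{\sqrt{n+1}+1}<\alpha<\frac{\sqrt{n+1}}{\sqrt{n+1}-1}.$$ In particular, $$C_{1,n,1}=\frac{2(n-2)}{n\omega_n}\left\{\frac{(n-1)^2}{(n-2)(n+1)}\right\}^{(n+2)/2}.$$ If $\alpha$ satisfies condition $( * )$, then the coefficient $\mathcal{C}_{\alpha,n,1}(x)$ is sharp also in the weaker inequality obtained by replacing $\nabla(x_n^{n\alpha-1}v)$ by $\partial(x_n^{n\alpha-1}v)/\partial x_n$.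
   Context: $\mathbb{R}^n_+=\{x=(x',x_n):x'\in\mathbb{R}^{n-1},\ x_n>0\}$; $\omega_n=2\pi^{n/2}/\Gamma(n/2)$ is the area of the unit sphere in $\mathbb{R}^n$. $h^1(\mathbb{R}^n_+)$ is the Hardy space of harmonic functions on $\mathbb{R}^n_+$ which can be represented as the Poisson integral $v(x)=\frac{2}{\omega_n}\int_{\mathbb{R}^{n-1}}\frac{x_n}{|y-x|^n}v(y')\,dy'$, $y=(y',0)$, with boundary values $v(y')$ in $L^1(\mathbb{R}^{n-1})$; $\|v\|_1$ is the $L^1(\mathbb{R}^{n-1})$-norm of the boundary values. ''Sharp coefficient'' at a given $x$ means the smallest one for which the inequality holds for all $v\in h^1(\mathbb{R}^n_+)$.
   Formalization: In the middle range the exponent (n+2)/2 of α²/(n+1) is corrected to (n+1)/2; C_{1,n,1} is corrected to (2n/ω_n) n^{n/2}/(n+1)^{(n+1)/2}, and the printed braces expression is given, with exponent (n+1)/2 and prefactor 2√(n−2)/ω_n, as the value at α=(n−1)/n. *)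

(* Defs.v *)
From HB Require Import structures.
From mathcomp Require Import all_boot all_order all_algebra.
From mathcomp Require Import all_classical all_reals all_analysis.

Set Implicit Arguments.
Unset Strict Implicit.
Unset Printing Implicit Defensive.

Import Order.TTheory GRing.Theory Num.Theory.
Import numFieldNormedType.Exports.

Local Open Scope classical_set_scope.
Local Open Scope ring_scope.

(* Lebesgue measure on R^m, carried by the measurable type of m-tuples, as the
   image of the iterated product measure under (a, t) |-> a :: t. *)
Section lebesgue_cons.
Context (R : realType) (m : nat).
Variable mu : {sigma_finite_measure set (m.-tuple (measurableTypeR R)) -> \bar R}.

Definition tcons (p : measurableTypeR R * m.-tuple (measurableTypeR R)) :
  m.+1.-tuple (measurableTypeR R) := [tuple of p.1 :: p.2].

Lemma measurable_tcons : measurable_fun [set: _] tcons.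
Proof. by apply: measurable_cons. Qed.

Definition lebesgue_cons : set (m.+1.-tuple (measurableTypeR R)) -> \bar R :=
  pushforward (@lebesgue_measure R \x mu)%E tcons.

Let lebesgue_cons0 : lebesgue_cons set0 = 0%E.
Proof. by rewrite /lebesgue_cons /pushforward preimage_set0 measure0. Qed.

Let lebesgue_cons_ge0 A : (0 <= lebesgue_cons A)%E.
Proof. by rewrite /lebesgue_cons /pushforward measure_ge0. Qed.

Let lebesgue_cons_sigma_additive : semi_sigma_additive lebesgue_cons.
Proof.
move=> F mF tF mUF; rewrite /lebesgue_cons /pushforward preimage_bigcup.
have mtc B : measurable B -> measurable (tcons @^-1` B).
  by move=> mB; rewrite -[X in measurable X]setTI; exact: measurable_tcons.
apply: measure_semi_sigma_additive.
- by move=> n; exact: mtc.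
- apply/trivIsetP => /= i j _ _ ij; rewrite -preimage_setI.
  by move/trivIsetP : tF => /(_ _ _ _ _ ij) ->//; rewrite preimage_set0.
- by rewrite -preimage_bigcup; exact: mtc.
Qed.

HB.instance Definition _ := isMeasure.Build _ _ _ lebesgue_cons
  lebesgue_cons0 lebesgue_cons_ge0 lebesgue_cons_sigma_additive.

Let lebesgue_cons_sigma_finite : sigma_finite setT lebesgue_cons.
Proof.
have /sigma_finiteP[F [TF ndF Foo]] := sigma_finiteT (@lebesgue_measure R).
have /sigma_finiteP[G [TG ndG Goo]] := sigma_finiteT mu.
pose uncons (t : m.+1.-tuple (measurableTypeR R)) :=
  (thead t, [tuple of behead t] : m.-tuple (measurableTypeR R)).
have mu_uncons : measurable_fun [set: _] uncons.
  apply/measurable_fun_pairP; split.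
    exact: measurable_tnth.
  exact: measurable_behead.
have unconsK p : uncons (tcons p) = p.
  by case: p => a t; rewrite /uncons /tcons theadE; congr pair; exact: val_inj.
have TFG : [set: measurableTypeR R * m.-tuple (measurableTypeR R)] =
    \bigcup_k (F k `*` G k).
  rewrite -setXTT TF TG predeqE => -[x y]; split.
    move=> [/= [n _ Fnx] [k _ Gky]]; exists (maxn n k) => //; split.
    - by move: x Fnx; exact/subsetPset/ndF/leq_maxl.
    - by move: y Gky; exact/subsetPset/ndG/leq_maxr.
  by move=> [n _ []/= ? ?]; split; exists n.
exists (fun k => uncons @^-1` (F k `*` G k)).
  by rewrite -preimage_bigcup -TFG preimage_setT.
move=> k; have [? ?] := Foo k; have [? ?] := Goo k; split.
  rewrite -[X in measurable X]setTI; apply: mu_uncons => //.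
  exact: measurableX.
rewrite /lebesgue_cons /pushforward (_ : tcons @^-1` _ = F k `*` G k); last first.
  by apply/funext => p; rewrite /preimage /mkset unconsK.
by rewrite product_measure1E// lte_mul_pinfty// ge0_fin_numE.
Qed.

HB.instance Definition _ := Measure_isSigmaFinite.Build _ _ _ lebesgue_cons
  lebesgue_cons_sigma_finite.

End lebesgue_cons.

Fixpoint lebesgue_tuple (R : realType) (m : nat) :
    {sigma_finite_measure set (m.-tuple (measurableTypeR R)) -> \bar R} :=
  match m with
  | 0 => \d_([tuple])
  | k.+1 => lebesgue_cons (lebesgue_tuple R k)
  end.

Section half_space.
Context {R : realType}.

Definition Gamma (s : R) : R :=
  \int[@lebesgue_measure R]_(t in `]0, +oo[) (t `^ (s - 1) * expR (- t)).

Definition sphere_area (n : nat) : R :=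
  2 * pi `^ (n%:R / 2) / Gamma (n%:R / 2).

(* The norm carried by 'rV[R]_n in the library is the sup norm. *)
Definition enorm n (u : 'rV[R]_n) : R := Num.sqrt (\sum_i u 0 i ^+ 2).

Definition partial n (i : 'I_n) (u : 'rV[R]_n -> R) : 'rV[R]_n -> R :=
  'D_(delta_mx 0 i) u.

Definition grad n (u : 'rV[R]_n -> R) (x : 'rV[R]_n) : 'rV[R]_n :=
  \row_i partial i u x.

(* C^2 with vanishing Laplacian on the open set U. *)
Definition harmonic_on n (U : set 'rV[R]_n) (u : 'rV[R]_n -> R) : Prop :=
  (forall x, U x -> forall i j,
     [/\ derivable u x (delta_mx 0 i),
         derivable (partial i u) x (delta_mx 0 j) &
         {for x, continuous (partial j (partial i u))}]) /\
  (forall x, U x -> \sum_i partial i (partial i u) x = 0).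

(* From here on the space is R^n with n = m.+1, and the last coordinate of
   x = (x', x_n) is x 0 ord_max. Points of the boundary R^(n-1) are m-tuples. *)
Context {m : nat}.
Implicit Types (x : 'rV[R]_m.+1) (v : 'rV[R]_m.+1 -> R).
Implicit Types (y : m.-tuple (measurableTypeR R)).
Implicit Types (f : m.-tuple (measurableTypeR R) -> R).

Definition xlast x : R := x 0 ord_max.

Definition half_space : set 'rV[R]_m.+1 := [set x | 0 < xlast x].

Definition boundary_point y : 'rV[R]_m.+1 :=
  \row_i (if unlift ord_max i is Some j then tnth y j else 0).

Definition poisson f x : R :=
  2 / sphere_area m.+1 *
  \int[lebesgue_tuple R m]_y
    (xlast x / enorm (boundary_point y - x) ^+ m.+1 * f y).

(* v is in the Hardy space h^1, with boundary values f. *)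
Definition hardy1 v f : Prop :=
  [/\ harmonic_on half_space v,
      (lebesgue_tuple R m).-integrable setT (EFin \o f) &
      forall x, half_space x -> v x = poisson f x].

Definition L1norm f : R := fine ('N[lebesgue_tuple R m]_1%E[EFin \o f])%E.

(* C is the smallest coefficient in the inequality F v <= C * |v|_1 on h^1. *)
Definition sharp_coefficient (F : ('rV[R]_m.+1 -> R) -> R) (C : R) : Prop :=
  let valid c := forall v f, hardy1 v f -> F v <= c * L1norm f in
  valid C /\ lbound valid C.

Definition weighted (alpha : R) v x : R :=
  xlast x `^ (m.+1%:R * alpha - 1) * v x.

End half_space.

(* Main.v *)
Require Import Defs.
From HB Require Import structures.
From mathcomp Require Import all_boot all_order all_algebra.
From mathcomp Require Import all_classical all_reals all_analysis.
From mathcomp Require Import measurable_realfun ring lra.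

Set Implicit Arguments.
Unset Strict Implicit.
Unset Printing Implicit Defensive.

Import Order.TTheory GRing.Theory Num.Theory.
Import numFieldNormedType.Exports.

Local Open Scope classical_set_scope.
Local Open Scope ring_scope.

(** The gradient of the weighted Poisson integral at x is an average of explicit
    vectors against the boundary values: differentiating under the integral,
    grad (x_n^(n alpha - 1) v)(x) is the integral of V(x - y) f(y), where
      V(d) = (2 n / omega) d_n^(n alpha - 1) |d|^(-n) (alpha e_n - (d_n/|d|) d/|d|).
    Hence the gradient is at most (sup_y |V(x - y)|) |f|_1, and the constant is
    optimal because f may be concentrated near a boundary point at which the
    supremum is attained. With t = (x_n/|y - x|)^2, which takes exactly the
    values 0 < t <= 1 (there is a horizontal direction to move in), the length
    of V is (2 n / omega) x_n^(n (alpha - 1) - 1) times the square root of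
      t^n (alpha^2 - (2 alpha - 1) t).
    This profile increases up to t = n alpha^2 / ((n + 1) (2 alpha - 1)) when
    2 alpha > 1 and is increasing otherwise; comparing that point with 1 is
    the dichotomy between the two formulas. In the case t = 1 the extremal
    vector V is vertical, which is why the last partial derivative alone
    already has the same sharp constant.

    The analytic part works with functions k of d = x - y only. The Poisson
    kernel and its derivatives are polynomials in rho = 1/|d| and the direction
    cosines d_i/|d|, an algebra stable under differentiation whose members are
    bounded and Lipschitz away from the boundary ([tame]). That gives
    continuity ([kernel_int_continuous]) and differentiation under the integral
    ([is_derive_kernel_int]), hence that every Poisson integral of an integrable
    function is harmonic ([hardy1_poisson]) -- so that test functions are
    available -- and the formula above ([partial_weighted]). The two
    inequalities are [sum_partial_weighted_le] and [sharp_lower_bound]; the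
    maximization is [profile_le] and [profile_attained]. The vector nature of
    the gradient is handled by testing it against vectors w of length at most 1
    ([cauchy_schwarz_unit], [enorm_dual]). *)

(** * The Euclidean norm and kernels bounded away from the boundary *)

Section kernels.
Context {R : realType} {m : nat}.
Local Notation V := 'rV[R]_m.+1.
Local Notation Y := (m.-tuple (measurableTypeR R)).
Local Notation e_ i := (delta_mx 0 i : V).
Implicit Types (d x b : V) (y : Y) (k : V -> R).

Definition rho d : R := (enorm d)^-1.
Definition dircos (i : 'I_m.+1) d : R := d 0 i * rho d.

Lemma enorm_ge0 p (u : 'rV[R]_p) : 0 <= enorm u.
Proof. exact: sqrtr_ge0. Qed.

Lemma enorm_sqr p (u : 'rV[R]_p) : enorm u ^+ 2 = \sum_i u 0 i ^+ 2.
Proof. by rewrite sqr_sqrtr// sumr_ge0// => i _; rewrite sqr_ge0. Qed.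

Lemma coord_le_enorm p (u : 'rV[R]_p) i : `|u 0 i| <= enorm u.
Proof.
rewrite -sqrtr_sqr ler_sqrt; last by rewrite sumr_ge0// => j _; rewrite sqr_ge0.
by rewrite (bigD1 i)//= lerDl sumr_ge0// => j _; rewrite sqr_ge0.
Qed.

Lemma xlast_le_enorm d : xlast d <= enorm d.
Proof. exact: le_trans (ler_norm _) (coord_le_enorm d ord_max). Qed.

Lemma enorm_gt0 d : half_space d -> 0 < enorm d.
Proof. by move=> d0; exact: lt_le_trans (xlast_le_enorm d). Qed.

Lemma coord_le_norm p (u : 'rV[R]_p) i : `|u 0 i| <= `|u|.
Proof.
by rewrite [leRHS]/Num.Def.normr/= mx_normrE; exact: (le_bigmax _ _ (0, i)).
Qed.

(** Each |d_i^2 - d'_i^2| is at most |d - d'| (|d_i| + |d'_i|), and the sum of the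
    two norms divides out. *)
Lemma enorm_lipschitz d d' : `|enorm d - enorm d'| <= m.+1%:R * `|d - d'|.
Proof.
have [s0|s0] := eqVneq (enorm d + enorm d') 0.
  move/eqP : s0; rewrite paddr_eq0 ?enorm_ge0// => /andP[/eqP -> /eqP ->].
  by rewrite subr0 normr0 mulr_ge0.
have {}s0 : 0 < enorm d + enorm d' by rewrite lt_def s0 addr_ge0 ?enorm_ge0.
rewrite -(ler_pM2r s0) -{1}(gtr0_norm s0) -normrM -subr_sqr !enorm_sqr -sumrB.
rewrite (le_trans (ler_norm_sum _ _ _))//.
rewrite -mulrA mulr_natl.
have -> (z : R) : z *+ m.+1 = \sum_(i < m.+1) z by rewrite sumr_const card_ord.
apply: ler_sum => i _; rewrite subr_sqr normrM ler_pM//.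
  by have := coord_le_norm (d - d') i; rewrite !mxE.
by rewrite (le_trans (ler_normD _ _))// lerD// coord_le_enorm.
Qed.

(** Bounds uniform on each {h < d_n} are what makes integrals against an
    arbitrary L^1 function converge, and vary regularly with x. A Lipschitz
    bound rather than mere continuity makes the continuity of these integrals,
    and the size of a box on which k is almost constant, explicit. *)
Record tame k : Prop := Tame {
  tame_bounded : forall h, 0 < h ->
    exists M, 0 <= M /\ forall d, h < xlast d -> `|k d| <= M;
  tame_lipschitz : forall h, 0 < h -> exists L, 0 <= L /\
    forall d d', h < xlast d -> h < xlast d' -> `|k d - k d'| <= L * `|d - d'|;
  tame_measurable : forall x,
    measurable_fun [set: Y] (fun y => k (x - boundary_point y)) }.

Lemma tame_cst (c : R) : tame (fun=> c).
Proof.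
split=> // h h0; first by exists `|c|.
by exists 0; split=> // d d' _ _; rewrite subrr normr0 mul0r.
Qed.

Lemma tameD k k' : tame k -> tame k' -> tame (fun d => k d + k' d).
Proof.
move=> [bk lk mk] [bk' lk' mk']; split=> [h h0|h h0|x].
- have [M [M0 kM]] := bk _ h0; have [M' [M'0 kM']] := bk' _ h0.
  exists (M + M'); split=> [|d hd]; first exact: addr_ge0.
  by rewrite (le_trans (ler_normD _ _))// lerD ?kM ?kM'.
- have [M [M0 kM]] := lk _ h0; have [M' [M'0 kM']] := lk' _ h0.
  exists (M + M'); split=> [|d d' hd hd']; first exact: addr_ge0.
  by rewrite opprD addrACA mulrDl (le_trans (ler_normD _ _))// lerD ?kM ?kM'.
- exact: measurable_funD.
Qed.

Lemma tameM k k' : tame k -> tame k' -> tame (fun d => k d * k' d).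
Proof.
move=> [bk lk mk] [bk' lk' mk']; split=> [h h0|h h0|x].
- have [M [M0 kM]] := bk _ h0; have [M' [M'0 kM']] := bk' _ h0.
  exists (M * M'); split=> [|d hd]; first exact: mulr_ge0.
  by rewrite normrM ler_pM ?kM ?kM'.
- have [M [M0 kM]] := bk _ h0; have [M' [M'0 kM']] := bk' _ h0.
  have [L [L0 kL]] := lk _ h0; have [L' [L'0 kL']] := lk' _ h0.
  exists (L * M' + M * L'); split=> [|d d' hd hd'].
    by rewrite addr_ge0 ?mulr_ge0.
  rewrite (_ : _ - _ = (k d - k d') * k' d + k d' * (k' d - k' d')); last by ring.
  rewrite (le_trans (ler_normD _ _))// !normrM mulrDl lerD//.
    by rewrite mulrAC ler_pM ?kM' ?kL.
  by rewrite -mulrA ler_pM ?kM ?kL'.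
- exact: measurable_funM.
Qed.

Lemma tameX k p : tame k -> tame (fun d => k d ^+ p).
Proof.
move=> gk; elim: p => [|p IH]; first exact: tame_cst.
by under eq_fun do rewrite exprS; exact: tameM.
Qed.

Lemma measurable_boundary_point x i :
  measurable_fun [set: Y] (fun y => (x - boundary_point y) 0 i).
Proof.
rewrite (_ : (fun y => _) = fun y => x 0 i -
    (if unlift ord_max i is Some j then tnth y j else 0)); last first.
  by apply/funext => y; rewrite !mxE.
apply: measurable_funB; first exact: measurable_cst.
case: unliftP => [j _|_]; last exact: measurable_cst.
exact: measurable_tnth.
Qed.

Lemma rho_ge0 d : 0 <= rho d.
Proof. by rewrite invr_ge0 enorm_ge0. Qed.

Lemma rho_le d h : 0 < h -> h < xlast d -> rho d <= h^-1.
Proof.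
move=> h0 hd; have hd' := lt_le_trans hd (xlast_le_enorm d).
by rewrite lef_pV2 ?posrE ?(ltW hd')// (lt_trans h0).
Qed.

Lemma dircos_le1 i d : `|dircos i d| <= 1.
Proof.
rewrite /dircos /rho normrM normfV (ger0_norm (enorm_ge0 d)).
have [->|d0] := eqVneq (enorm d) 0; first by rewrite invr0 mulr0.
by rewrite ler_pdivrMr ?mul1r ?coord_le_enorm// lt_def d0 enorm_ge0.
Qed.

Lemma tame_rho : tame rho.
Proof.
split=> [h h0|h h0|x].
- exists h^-1; split=> [|d hd]; first by rewrite invr_ge0 ltW.
  by rewrite ger0_norm ?rho_ge0 ?rho_le.
- exists (m.+1%:R * h^-1 * h^-1); split=> [|d d' hd hd'].
    by rewrite !mulr_ge0 ?invr_ge0 ?(ltW h0).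
  have d0 : 0 < enorm d by apply: enorm_gt0; exact: lt_trans hd.
  have d'0 : 0 < enorm d' by apply: enorm_gt0; exact: lt_trans hd'.
  rewrite (_ : _ - _ = (enorm d' - enorm d) * (rho d * rho d')); last first.
    by rewrite /rho; field; rewrite !gt_eqF.
  rewrite normrM (ger0_norm (mulr_ge0 (rho_ge0 d) (rho_ge0 d'))) distrC.
  apply: (@le_trans _ _ ((m.+1%:R * `|d - d'|) * (h^-1 * h^-1))).
    by rewrite ler_pM ?mulr_ge0 ?rho_ge0 ?enorm_lipschitz// ler_pM ?rho_ge0 ?rho_le.
  by rewrite le_eqVlt; apply/orP; left; apply/eqP; ring.
- rewrite (_ : (fun y => _) = fun y => Num.sqrt
      (\sum_i (x - boundary_point y) 0 i ^+ 2) `^ (-1)); last first.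
    by apply/funext => y; rewrite powR_inv1// sqrtr_ge0.
  apply: (measurableT_comp (measurable_powR (-1 : R))).
  apply: (measurableT_comp (continuous_measurable_fun (@sqrt_continuous R))).
  apply: measurable_sum => i; apply: measurable_funX.
  exact: measurable_boundary_point.
Qed.

Lemma tame_dircos i : tame (dircos i).
Proof.
split=> [h h0|h h0|x].
- by exists 1; split=> // d _; exact: dircos_le1.
- have [M [M0 rM]] := tame_bounded tame_rho h0.
  exists (M + M * m.+1%:R); split=> [|d d' hd hd']; first by rewrite addr_ge0 ?mulr_ge0.
  have d0 : 0 < enorm d by apply: enorm_gt0; exact: lt_trans hd.
  have d'0 : 0 < enorm d' by apply: enorm_gt0; exact: lt_trans hd'.
  rewrite (_ : _ - _ = rho d * (d 0 i - d' 0 i) +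
      dircos i d' * (rho d * (enorm d' - enorm d))); last first.
    by rewrite /dircos /rho; field; rewrite !gt_eqF.
  rewrite (le_trans (ler_normD _ _))// !normrM mulrDl lerD//.
    rewrite ler_pM ?rM//.
    by have := coord_le_norm (d - d') i; rewrite !mxE.
  rewrite -[X in X * _ <= _]normrM -[leRHS]mulrA -[leRHS]mul1r.
  rewrite ler_pM ?mulr_ge0//; first exact: dircos_le1.
  by rewrite ler_pM ?rM// distrC enorm_lipschitz.
- by apply: measurable_funM; [exact: measurable_boundary_point|
    exact: tame_measurable tame_rho x].
Qed.
End kernels.

(** * Derivatives of the Poisson kernel *)

Section derivatives.
Context {R : realType} {m : nat}.
Local Notation V := 'rV[R]_m.+1.
Local Notation Y := (m.-tuple (measurableTypeR R)).
Local Notation e_ i := (delta_mx 0 i : V).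
Local Notation n := (m.+1%:R : R).
Implicit Types (d x b : V) (y : Y) (k : V -> R).

(** Directional derivatives of functions of d reduce to the calculus of one
    real variable. *)
Lemma is_derive_line (f : V -> R) x v (h df : R) :
  is_derive h 1 (fun t : R => f (t *: v + x)) df <->
  is_derive (h *: v + x) v f df.
Proof.
have E : (fun t : R => t^-1 *: (((fun t : R => f (t *: v + x)) \o shift h) (t *: 1)
    - f (h *: v + x))) =
  (fun t : R => t^-1 *: ((f \o shift (h *: v + x)) (t *: v) - f (h *: v + x))).
  by apply/funext => t /=; rewrite addrA -scalerDl [_%:A]mulr1.
by split=> -[d <-]; apply: DeriveDef; move: d; rewrite /derivable /derive E.
Qed.

Lemma is_derive_coord d i j : is_derive d (e_ j) (fun d : V => d 0 i) (i == j)%:R.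
Proof.
rewrite -[d in is_derive d](add0r d) -(scale0r (e_ j)); apply/is_derive_line.
rewrite (_ : (fun _ => _) = fun t : R => t * (i == j)%:R + d 0 i).
  by apply: is_derive_eq; rewrite addr0 scaler0 add0r [LHS]mulr1.
by apply/funext => t; rewrite !mxE.
Qed.

Lemma is_derive_rho d j : half_space d ->
  is_derive d (e_ j) (@rho R m) (- (dircos j d * rho d ^+ 2)).
Proof.
move=> /enorm_gt0 d0.
rewrite -[d in is_derive d](add0r d) -(scale0r (e_ j)); apply/is_derive_line.
rewrite (_ : (fun _ => _) = fun t : R =>
    (Num.sqrt (enorm d ^+ 2 + 2 * d 0 j * t + t ^+ 2))^-1).
  have s0 : 0 < enorm d ^+ 2 + 2 * d 0 j * 0 + 0 ^+ 2.
    by rewrite mulr0 expr0n !addr0 exprn_gt0.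
  have sd : is_derive (0 : R) (1 : R)
      (Num.sqrt \o (fun t => enorm d ^+ 2 + 2 * d 0 j * t + t ^+ 2))
      ((2 * enorm d)^-1 * (2 * d 0 j)).
    apply: is_derive1_comp.
      by apply: is_derive_eq; first exact: is_derive1_sqrt;
      rewrite mulr0 expr0n !addr0 sqrtr_sqr gtr0_norm.
    by apply: is_derive_eq; rewrite !scale0r add0r !addr0 mul1r [LHS]mulr1.
  case: sd => sd sdE; apply: DeriveDef.
    by apply: derivableV sd; rewrite /= gt_eqF// sqrtr_gt0.
  rewrite deriveV; last exact: sd; last by rewrite /= gt_eqF// sqrtr_gt0.
  rewrite [X in _ *: X]sdE /= mulr0 expr0n !addr0 sqrtr_sqr gtr0_norm//.
  by rewrite /dircos /rho -[LHS]/(_ * _); field; rewrite gt_eqF.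
apply/funext => t; rewrite /rho /enorm sqr_sqrtr; last first.
  by rewrite sumr_ge0// => i _; rewrite sqr_ge0.
congr (Num.sqrt _)^-1; rewrite (bigD1 j)//= [in RHS](bigD1 j)//= !mxE !eqxx/= mulr1.
under eq_bigr => i ij do rewrite !mxE eqxx (negbTE ij) mulr0 add0r.
by ring.
Qed.

Lemma is_derive_prod (W : normedModType R) (f g : W -> R) (x v : W) (df dg : R) :
  is_derive x v f df -> is_derive x v g dg ->
  is_derive x v (fun z => f z * g z) (df * g x + f x * dg).
Proof.
by move=> hf hg; apply: is_derive_eq; rewrite addrC [g x *: _]mulrC.
Qed.

Lemma is_derive_pow (f : V -> R) x v df p :
  is_derive x v f df ->
  is_derive x v (fun d => f d ^+ p.+1) (p.+1%:R * f x ^+ p * df).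
Proof.
by move=> hf; have := is_deriveX p.+1 hf; rewrite exprfctE.
Qed.

Lemma is_derive_dircos d i j : half_space d ->
  is_derive d (e_ j) (@dircos R m i) (rho d * ((i == j)%:R - dircos i d * dircos j d)).
Proof.
move=> d0; apply: is_derive_eq.
  exact: (is_derive_prod (is_derive_coord d i j) (is_derive_rho j d0)).
by rewrite {2}/dircos; ring.
Qed.

(** Grouped into direction cosines and powers of 1/|d|, so that boundedness away
    from the boundary can be read off. *)
Definition poisson_kernel d : R := dircos ord_max d * rho d ^+ m.

Definition poisson_kernel_grad (i : 'I_m.+1) d : R :=
  rho d ^+ m.+1 * ((ord_max == i)%:R + - n * (dircos ord_max d * dircos i d)).

Definition poisson_kernel_hess (i j : 'I_m.+1) d : R :=
  - n * rho d ^+ m.+2 *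
   ((ord_max == i)%:R * dircos j d + (ord_max == j)%:R * dircos i d
    + (i == j)%:R * dircos ord_max d
    + - (n + 2) * (dircos ord_max d * dircos i d * dircos j d)).

Lemma poisson_kernelE d : xlast d / enorm d ^+ m.+1 = poisson_kernel d.
Proof. by rewrite /poisson_kernel /dircos /rho -mulrA -exprS exprVn. Qed.

Lemma tame_poisson_kernel : tame poisson_kernel.
Proof. exact: tameM (tame_dircos _) (tameX _ tame_rho). Qed.

Lemma tame_poisson_kernel_grad i : tame (poisson_kernel_grad i).
Proof.
apply: tameM; first exact: tameX tame_rho.
apply: tameD; first exact: tame_cst.
by apply: tameM; [exact: tame_cst|apply: tameM; exact: tame_dircos].
Qed.

Lemma tame_poisson_kernel_hess i j : tame (poisson_kernel_hess i j).
Proof.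
have gc c p : tame (fun d => c * dircos p d).
  exact: tameM (tame_cst c) (tame_dircos p).
apply: tameM; first exact: tameM (tame_cst _) (tameX _ tame_rho).
apply: tameD; first exact: tameD (tameD (gc _ _) (gc _ _)) (gc _ _).
apply: tameM; first exact: tame_cst.
exact: tameM (tameM (tame_dircos _) (tame_dircos _)) (tame_dircos _).
Qed.

Lemma is_derive_poisson_kernel d i : half_space d ->
  is_derive d (e_ i) poisson_kernel (poisson_kernel_grad i d).
Proof.
move=> d0.
rewrite (_ : poisson_kernel = fun d => d 0 ord_max * rho d ^+ m.+1); last first.
  by apply/funext => b; rewrite /poisson_kernel /dircos exprS mulrA.
apply: is_derive_eq.
  exact: is_derive_prod (is_derive_coord d _ i) (is_derive_pow _ (is_derive_rho i d0)).
by rewrite /poisson_kernel_grad /dircos exprS; ring.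
Qed.

Lemma is_derive_poisson_kernel_grad d i j : half_space d ->
  is_derive d (e_ j) (poisson_kernel_grad i) (poisson_kernel_hess i j d).
Proof.
move=> d0; apply: is_derive_eq.
  apply: is_derive_prod; first exact: is_derive_pow (is_derive_rho j d0).
  apply: is_deriveD.
  apply: is_derive_prod.
  apply: is_derive_prod; exact: is_derive_dircos.
rewrite /poisson_kernel_hess/= !mul0r !add0r -[n]natr1 !exprS; ring.
Qed.

Lemma sum_sqr_dircos d : half_space d -> \sum_i dircos i d ^+ 2 = 1.
Proof.
move=> /enorm_gt0 d0; under eq_bigr do rewrite exprMn.
by rewrite -mulr_suml -enorm_sqr -exprMn mulfV ?expr1n// gt_eqF.
Qed.

(** In the trace the first two terms give d_n/|d| each and the third one n times
    that; the last term cancels these n + 2 since the squared cosines sum to 1. *)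
Lemma poisson_kernel_harmonic d : half_space d ->
  \sum_i poisson_kernel_hess i i d = 0.
Proof.
move=> d0; rewrite -mulr_sumr !big_split/=.
have -> : \sum_(i < m.+1) - (n + 2) * (dircos ord_max d * dircos i d * dircos i d) =
    - (n + 2) * dircos ord_max d.
  rewrite -[RHS]mulr1 -(sum_sqr_dircos d0) mulr_sumr.
  by apply: eq_bigr => i _; rewrite expr2 !mulrA.
have E (k : 'I_m.+1 -> R) : \sum_i (ord_max == i)%:R * k i = k ord_max.
  rewrite (bigD1 ord_max)//= eqxx mul1r big1 ?addr0// => i /negbTE.
  by rewrite eq_sym => ->; rewrite mul0r.
rewrite !E.
under eq_bigr do rewrite eqxx mul1r.
rewrite sumr_const card_ord -mulr_natl; ring.
Qed.
End derivatives.

(** * Integrals of kernels against integrable boundary values *)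

Section kernel_integrals.
Context {R : realType} {m : nat}.
Local Notation V := 'rV[R]_m.+1.
Local Notation Y := (m.-tuple (measurableTypeR R)).
Local Notation e_ i := (delta_mx 0 i : V).
Local Notation leb := (lebesgue_tuple R m).
Implicit Types (d x b : V) (y : Y) (k : V -> R) (f : Y -> R).

Lemma xlast_sub_boundary x y : xlast (x - boundary_point y) = xlast x.
Proof. by rewrite /xlast !mxE unlift_none subr0. Qed.

Lemma half_space_sub_boundary x y : half_space x -> half_space (x - boundary_point y).
Proof. by rewrite /half_space/= xlast_sub_boundary. Qed.

Lemma half_space_nbhs x : half_space x -> \forall x' \near x, half_space x'.
Proof.
move=> x0.
have cx : {for x, continuous (@xlast R m)}.
  exact: coord_continuous.
exact: (cvgr_gt (xlast x) cx).
Qed.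

(** The convolution of k with f. Keeping the kernel a function of x - y alone
    turns derivatives in x into derivatives of k. *)
Definition kernel_int k f x : R := \int[leb]_y (k (x - boundary_point y) * f y).

Lemma integrable_kernel k f x : half_space x -> tame k ->
  leb.-integrable setT (EFin \o f) ->
  leb.-integrable setT (EFin \o (fun y => k (x - boundary_point y) * f y)).
Proof.
move=> x0 gk intf.
have x20 : 0 < xlast x / 2 by rewrite divr_gt0.
have [M [M0 kM]] := tame_bounded gk x20.
apply: (@le_integrable _ _ _ _ _ measurableT _ (fun y => (M%:E * (f y)%:E)%E)).
- apply/measurable_EFinP; apply: measurable_funM.
    exact: tame_measurable gk x.
  by case/integrableP : intf => /measurable_EFinP.
- move=> y _; rewrite -EFinM /= lee_fin !normrM (ger0_norm M0) ler_wpM2r//.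
  by rewrite kM// xlast_sub_boundary; have : 0 < xlast x := x0; lra.
- exact: integrableZl.
Qed.

Lemma kernel_int_continuous k f x : half_space x -> tame k ->
  leb.-integrable setT (EFin \o f) -> {for x, continuous (kernel_int k f)}.
Proof.
move=> x0 gk intf; have {}x0 : 0 < xlast x := x0.
have x20 : 0 < xlast x / 2 by rewrite divr_gt0.
have [L [L0 kL]] := tame_lipschitz gk x20.
have intnf : leb.-integrable setT (EFin \o (fun y => `|f y|)).
  exact: integrable_norm.
have nf0 : 0 <= \int[leb]_y `|f y| by exact: Rintegral_ge0.
set N := \int[leb]_y `|f y| in nf0.
(* The added 1 keeps the divisor positive when f or L vanishes. *)
have LN0 : 0 < L * N + 1 by rewrite ltr_wpDl// mulr_ge0.
apply/(@cvgrPdist_lt _ _ _ (nbhs x)) => e e0.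
have near_last : \forall x' \near x, xlast x / 2 < xlast x'.
  have cx : {for x, continuous (@xlast R m)} by exact: coord_continuous.
  apply: (cvgr_gt (xlast x) cx); lra.
have near_ball : \forall x' \near x, `|x - x'| < e / (L * N + 1).
  have := @cvgr_dist_lt _ _ _ (nbhs x) _ id x cvg_id.
  by apply; rewrite divr_gt0.
move: near_last near_ball; apply: filterS2 => x' x'x x'e.
have x'0 : half_space x' by exact: lt_trans x'x.
rewrite /kernel_int -RintegralB//; [|exact: integrable_kernel..].
apply: (@le_lt_trans _ _ (L * `|x - x'| * \int[leb]_y `|f y|)).
  rewrite -RintegralZl// (le_trans (le_normr_Rintegral _ _))//.
    have := integrableB measurableT (integrable_kernel x0 gk intf)
      (integrable_kernel x'0 gk intf).
    exact.
  apply: le_Rintegral => //.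
  - apply: integrable_norm.
    have := integrableB measurableT (integrable_kernel x0 gk intf)
      (integrable_kernel x'0 gk intf).
    exact.
  - have := integrableZl measurableT (L * `|x - x'|) intnf.
    by apply: eq_integrable.
  - move=> y _; rewrite -mulrBl normrM ler_wpM2r//.
    have -> : x - x' = (x - boundary_point y) - (x' - boundary_point y).
      by rewrite opprB addrA subrK.
    by apply: kL; rewrite xlast_sub_boundary//; lra.
rewrite -/N mulrAC; move: x'e; rewrite ltr_pdivlMr// => /le_lt_trans; apply.
by rewrite mulrC ler_wpM2l// lerDl.
Qed.

(** On the segment |t| < x_n / 2 the points x + t e_j stay in {x_n / 2 < d_n},
    where k' has a uniform bound M; M |f| then dominates the derivative. *)
Lemma is_derive_kernel_int k k' f x j : half_space x -> tame k -> tame k' ->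
  leb.-integrable setT (EFin \o f) ->
  (forall d, half_space d -> is_derive d (e_ j) k (k' d)) ->
  is_derive x (e_ j) (kernel_int k f) (kernel_int k' f x).
Proof.
move=> x0 gk gk' intf dk; have {}x0 : 0 < xlast x := x0.
have x20 : 0 < xlast x / 2 by rewrite divr_gt0.
have [M [M0 kM]] := tame_bounded gk' x20.
rewrite -[x in is_derive x](add0r x) -(scale0r (e_ j)); apply/is_derive_line.
pose g (t : R) y := k (t *: e_ j + x - boundary_point y) * f y.
pose a := xlast x / 2.
pose I : set R := [set` `]- a, a[].
have Ia : I 0 by rewrite /I/= in_itv/= oppr_lt0 x20.
have Ix t : I t -> xlast x / 2 < xlast (t *: e_ j + x).
  rewrite /I/= in_itv/= /xlast !mxE eqxx/= => /andP[ta ta'].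
  by case: (_ == _); rewrite ?mulr1 ?mulr0 ?add0r; rewrite /a /xlast in ta ta' x0 *; lra.
have dg t y : I t ->
    is_derive t 1 (g ^~ y) (k' (t *: e_ j + x - boundary_point y) * f y).
  move=> /Ix tx.
  have : is_derive (t *: e_ j + (x - boundary_point y)) (e_ j) k
      (k' (t *: e_ j + x - boundary_point y)).
    rewrite addrA; apply: dk; apply: half_space_sub_boundary.
    exact: lt_trans tx.
  move/is_derive_line => dkt.
  rewrite /g; under eq_fun do rewrite -addrA.
  have dc : is_derive t 1 (fun _ : R => f y) (0 : R) by exact: is_derive_cst.
  by have := is_derive_prod dkt dc; rewrite mulr0 addr0.
have d1g t y : I t ->
    partial1of2 g t y = k' (t *: e_ j + x - boundary_point y) * f y.
  by move=> It; rewrite partial1of2E; have := dg t y It => -[_].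
have intg t : I t -> leb.-integrable setT (EFin \o g t).
  by move=> /Ix tx; apply: integrable_kernel => //; exact: lt_trans tx.
have intG : leb.-integrable setT (EFin \o (fun y => M * `|f y|)).
  have := integrableZl measurableT M (integrable_norm intf).
  by apply: eq_integrable.
have cvgd : h^-1 *:
    (kernel_int k f ((h + 0) *: e_ j + x) - kernel_int k f (0 *: e_ j + x))
    @[h --> 0^'] --> kernel_int k' f (0 *: e_ j + x).
  have := @cvg_differentiation_under_integral R _ _ leb g setT measurableT 0
    (- a) a Ia intg _ (fun y => M * `|f y|) _ intG _.
  rewrite (_ : \int[leb]_y partial1of2 g 0 y =
      kernel_int k' f (0 *: e_ j + x)); last first.
    by apply: eq_Rintegral => y _; rewrite d1g.
  apply.
  - by move=> t y It _; case: (dg t y It).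
  - by move=> y; rewrite mulr_ge0.
  - move=> t y It _; rewrite d1g// normrM ler_wpM2r// kM//.
    by rewrite xlast_sub_boundary Ix.
rewrite [X in _ --> kernel_int k' f X](_ : _ = x) in cvgd; last first.
  by rewrite scale0r add0r.
apply: DeriveDef.
  by apply/cvg_ex; exists (kernel_int k' f x); under eq_fun do rewrite /= [_%:A]mulr1.
by apply/cvg_lim => //; under eq_fun do rewrite /= [_%:A]mulr1.
Qed.
End kernel_integrals.

(** * Poisson integrals and their weighted gradients *)

Section poisson_integral.
Context {R : realType} {m : nat}.
Local Notation V := 'rV[R]_m.+1.
Local Notation Y := (m.-tuple (measurableTypeR R)).
Local Notation e_ i := (delta_mx 0 i : V).
Local Notation leb := (lebesgue_tuple R m).
Local Notation n := (m.+1%:R : R).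
Local Notation omega := (sphere_area m.+1 : R).
Implicit Types (d x b : V) (y : Y) (k : V -> R) (f : Y -> R).

Lemma poissonE f x :
  poisson f x = 2 / omega * kernel_int poisson_kernel f x.
Proof.
rewrite /poisson; congr (_ * _); apply: eq_Rintegral => y _; congr (_ * _).
rewrite -poisson_kernelE xlast_sub_boundary; congr (_ / (Num.sqrt _) ^+ _).
by apply: eq_bigr => i _; rewrite -sqrrN !mxE opprB.
Qed.

Lemma eq_kernel_int k k' f x : (forall d, xlast d = xlast x -> k d = k' d) ->
  kernel_int k f x = kernel_int k' f x.
Proof.
by move=> kk'; apply: eq_Rintegral => y _; rewrite kk'// xlast_sub_boundary.
Qed.

Lemma kernel_intZ k f x c : half_space x -> tame k ->
  leb.-integrable setT (EFin \o f) ->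
  kernel_int (fun d => c * k d) f x = c * kernel_int k f x.
Proof.
move=> x0 gk intf; rewrite /kernel_int -RintegralZl//; last exact: integrable_kernel.
by apply: eq_Rintegral => y _; rewrite mulrA.
Qed.

Lemma kernel_int_sum (I : Type) (s : seq I) (k : I -> V -> R) f x : half_space x ->
  (forall i, tame (k i)) -> leb.-integrable setT (EFin \o f) ->
  kernel_int (fun d => \sum_(i <- s) k i d) f x = \sum_(i <- s) kernel_int (k i) f x.
Proof.
move=> x0 gk intf; elim: s => [|i s IH].
  rewrite big_nil -[RHS](mul0r (kernel_int (fun=> 0) f x)) -kernel_intZ//;
    last exact: (tame_cst (0 : R)).
  by apply: eq_kernel_int => d _; rewrite big_nil mul0r.
have gs : tame (fun d => \sum_(i <- s) k i d).
  elim: s {IH} => [|j s IH].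
    by under eq_fun do rewrite big_nil; exact: tame_cst.
  by under eq_fun do rewrite big_cons; exact: tameD (gk j) IH.
rewrite big_cons -IH /kernel_int -RintegralD//; [|exact: integrable_kernel|
  exact: (integrable_kernel x0 gs intf)].
by apply: eq_Rintegral => y _; rewrite big_cons mulrDl.
Qed.

Lemma is_derive_const_mul (f : V -> R) (c : R) x v df :
  is_derive x v f df -> is_derive x v (fun z => c * f z) (c * df).
Proof.
have dc : is_derive x v (fun _ : V => c) (0 : R) by exact: is_derive_cst.
by move=> dfx; have := is_derive_prod dc dfx; rewrite mul0r add0r.
Qed.

Lemma is_derive_poisson f x i : half_space x -> leb.-integrable setT (EFin \o f) ->
  is_derive x (e_ i) (poisson f) (2 / omega * kernel_int (poisson_kernel_grad i) f x).
Proof.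
move=> x0 intf.
rewrite (_ : poisson f = fun x => 2 / omega * kernel_int poisson_kernel f x).
  apply: is_derive_const_mul; apply: is_derive_kernel_int => //.
  - exact: tame_poisson_kernel.
  - exact: tame_poisson_kernel_grad.
  - by move=> d; exact: is_derive_poisson_kernel.
by apply/funext => z; rewrite poissonE.
Qed.

Lemma is_derive_partial_poisson f x i j : half_space x ->
  leb.-integrable setT (EFin \o f) ->
  is_derive x (e_ j) (partial i (poisson f))
    (2 / omega * kernel_int (poisson_kernel_hess i j) f x).
Proof.
move=> x0 intf; apply: (@near_eq_is_derive _ _ _
    (fun x => 2 / omega * kernel_int (poisson_kernel_grad i) f x)).
  apply: (filterS _ (half_space_nbhs x0)) => z z0.
  by case: (is_derive_poisson i z0 intf) => _ <-.
apply: is_derive_const_mul; apply: is_derive_kernel_int => //.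
- exact: tame_poisson_kernel_grad.
- exact: tame_poisson_kernel_hess.
- by move=> d; exact: is_derive_poisson_kernel_grad.
Qed.

(** The Laplacian falls on the kernel. *)
Lemma harmonic_poisson f : leb.-integrable setT (EFin \o f) ->
  harmonic_on half_space (poisson f).
Proof.
move=> intf; have E x i j : half_space x ->
    partial j (partial i (poisson f)) x =
      2 / omega * kernel_int (poisson_kernel_hess i j) f x.
  by move=> x0; case: (is_derive_partial_poisson i j x0 intf) => _ <-.
split=> x x0.
  move=> i j; split.
  - by case: (is_derive_poisson i x0 intf).
  - by case: (is_derive_partial_poisson i j x0 intf).
  - rewrite /prop_for/continuous_at E//.
    have : (2 / omega * kernel_int (poisson_kernel_hess i j) f z) @[z --> x] -->
        2 / omega * kernel_int (poisson_kernel_hess i j) f x.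
      exact: cvgM (cvg_cst _)
        (kernel_int_continuous x0 (tame_poisson_kernel_hess i j) intf).
    apply: cvg_trans.
    have nE : {near nbhs x,
        (fun z => 2 / omega * kernel_int (poisson_kernel_hess i j) f z) =1
        partial j (partial i (poisson f))}.
      by apply: filterS (half_space_nbhs x0) => z z0; rewrite E.
    exact: near_eq_cvg nE.
under eq_bigr do rewrite E//.
rewrite -mulr_sumr -kernel_int_sum//; last by move=> i; exact: tame_poisson_kernel_hess.
rewrite (@eq_kernel_int _ (fun _ => 0 * 0)) => [|d dx].
  by rewrite kernel_intZ ?mul0r ?mulr0//; exact: tame_cst.
by rewrite mul0r poisson_kernel_harmonic// /half_space/= dx.
Qed.

Lemma hardy1_poisson f : leb.-integrable setT (EFin \o f) ->
  hardy1 (poisson f) f.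
Proof. by move=> intf; split=> //; exact: harmonic_poisson. Qed.

Lemma is_derive_xlast_powR x (a : R) i : half_space x ->
  is_derive x (e_ i) (fun z => xlast z `^ a)
    ((ord_max == i)%:R * (a * xlast x `^ (a - 1))).
Proof.
move=> x0.
rewrite -[x in is_derive x](add0r x) -(scale0r (e_ i)); apply/is_derive_line.
rewrite (_ : (fun _ => _) = (fun r => r `^ a) \o
    (fun t : R => t * (ord_max == i)%:R + xlast x)); last first.
  by apply/funext => t; rewrite /xlast /= !mxE.
rewrite mulrC; apply: is_derive1_comp.
  rewrite mul0r add0r.
  exact: is_derive1_powR.
by apply: is_derive_eq; rewrite addr0 scaler0 add0r [LHS]mulr1.
Qed.

(** Up to the factor n d_n^(n alpha - 1), the i-th partial derivative of
    d_n^(n alpha - 1) times the Poisson kernel. Since d_n = x_n is fixed in the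
    integral over the boundary, that factor, unbounded in d, can be kept out of
    the kernel, which makes it tame for every alpha. *)
Definition gradient_kernel (alpha : R) (i : 'I_m.+1) d : R :=
  rho d ^+ m.+1 * (alpha * (ord_max == i)%:R - dircos ord_max d * dircos i d).

Lemma tame_gradient_kernel alpha i : tame (gradient_kernel alpha i).
Proof.
apply: tameM; first exact: tameX tame_rho.
apply: tameD; first exact: tame_cst.
rewrite (_ : (fun _ => _) = fun d => (-1) * (dircos ord_max d * dircos i d)).
  by apply: tameM; [exact: tame_cst|apply: tameM; exact: tame_dircos].
by apply/funext => d; rewrite mulN1r.
Qed.

Lemma partial_weighted alpha v f x i : half_space x -> hardy1 v f ->
  partial i (weighted alpha v) x =
  2 * n / omega * xlast x `^ (n * alpha - 1) * kernel_int (gradient_kernel alpha i) f x.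
Proof.
move=> x0 [_ intf vE].
have x0' : 0 < xlast x := x0.
have dP := is_derive_poisson i x0 intf.
have := is_derive_prod (is_derive_xlast_powR (n * alpha - 1) i x0) dP.
move=> /near_eq_is_derive => /(_ (weighted alpha v)) [].
  by apply: (filterS _ (half_space_nbhs x0)) => z z0; rewrite /weighted vE.
move=> _; rewrite -/(partial i (weighted alpha v) x) => ->.
rewrite poissonE.
have -> : xlast x `^ (n * alpha - 1) = xlast x * xlast x `^ (n * alpha - 1 - 1).
  by rewrite -{2}(powRr1 (ltW x0')) -powRD ?subrKC// (gt_eqF x0') implybT.
set p := xlast x `^ _.
rewrite (_ : _ + _ = 2 / omega * p * (
    (ord_max == i)%:R * (n * alpha - 1) * kernel_int poisson_kernel f x +
    xlast x * kernel_int (poisson_kernel_grad i) f x)); last by ring.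
rewrite [RHS](_ : _ = 2 / omega * p *
    (n * xlast x * kernel_int (gradient_kernel alpha i) f x)); last by ring.
congr (_ * _).
rewrite -!kernel_intZ//; try by [exact: tame_poisson_kernel|
  exact: tame_poisson_kernel_grad|exact: tame_gradient_kernel].
rewrite /kernel_int -RintegralD//; last 2 first.
- exact: (integrable_kernel x0 (tameM (tame_cst _) tame_poisson_kernel) intf).
- exact: (integrable_kernel x0 (tameM (tame_cst _) (tame_poisson_kernel_grad i)) intf).
apply: eq_Rintegral => y _; rewrite -mulrDl; congr (_ * _).
set d := x - _; rewrite -(xlast_sub_boundary x y) -/d.
rewrite -poisson_kernelE /poisson_kernel_grad /gradient_kernel /rho exprVn; ring.
Qed.
End poisson_integral.

(** * Bounds for the weighted gradient *)

Section boxes.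
Context {R : realType}.

Definition box m (y0 : m.-tuple (measurableTypeR R)) (delta : R) :
    set (m.-tuple (measurableTypeR R)) :=
  [set y | forall j, `|(tnth y j : R) - tnth y0 j| < delta].

Lemma measurable_box m (y0 : m.-tuple (measurableTypeR R)) delta :
  measurable (box y0 delta).
Proof.
have -> : box y0 delta = \bigcap_(j in [set: 'I_m])
    ((fun y => tnth y j) @^-1` `](tnth y0 j - delta : R), tnth y0 j + delta[).
  apply/seteqP; split => y /=.
    by move=> yb j _ /=; rewrite in_itv/= -ltr_distl.
  by move=> yb j; have := yb j I; rewrite /= in_itv/= -ltr_distl.
apply: fin_bigcap_measurable => // j _.
rewrite -[X in measurable X]setTI; apply: measurable_tnth => //.
Qed.

(** Positivity and finiteness, all that normalizing a test function requires,
    pass through the product of the measures. *)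
Lemma lebesgue_tuple_box m (y0 : m.-tuple (measurableTypeR R)) (delta : R) :
  0 < delta ->
  (0 < lebesgue_tuple R m (box y0 delta) < +oo)%E.
Proof.
move=> d0; elim: m y0 => [|m IH] y0.
  rewrite /= diracE mem_set ?lte01 ?ltry//.
  by case.
rewrite /= /lebesgue_cons /pushforward.
have -> : @tcons R m @^-1` box y0 delta =
   `](thead y0 - delta : R), thead y0 + delta[ `*` box [tuple of behead y0] delta.
  have liftE (i : 'I_m) : inord i.+1 = lift ord0 i :> 'I_m.+1.
    by apply: val_inj; rewrite /= inordK ?ltnS.
  apply/seteqP; split => [[a y] ab|[a y] [/= aI yb] j] /=.
    split => /=; first by have := ab ord0; rewrite (tnth_nth 0) in_itv/= -ltr_distl.
    by move=> j; have := ab (lift ord0 j); rewrite !tnthS tnth_behead liftE.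
  case: (unliftP ord0 j) => [i ->|->].
    by have := yb i; rewrite tnthS tnth_behead liftE.
  by move: aI; rewrite in_itv/= -ltr_distl (tnth_nth 0).
rewrite product_measure1E//; last exact: measurable_box.
have /andP[b0 boo] := IH [tuple of behead y0].
rewrite [X in (X * _)%E](_ : _ = (delta * 2)%:E); last first.
  rewrite [LHS]lebesgue_measure_itv/= lte_fin ifT; last lra.
  by rewrite -EFinD; congr EFin; ring.
have d20 : 0 < delta * 2 by lra.
by rewrite mule_gt0 ?lte_fin// lte_mul_pinfty// lee_fin ltW.
Qed.
End boxes.

Section gradient_bounds.
Context {R : realType} {m : nat}.
Local Notation V := 'rV[R]_m.+1.
Local Notation Y := (m.-tuple (measurableTypeR R)).
Local Notation leb := (lebesgue_tuple R m).
Local Notation n := (m.+1%:R : R).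
Local Notation omega := (sphere_area m.+1 : R).
Implicit Types (d x : V) (y : Y) (k : V -> R) (f : Y -> R) (w : 'I_m.+1 -> R).

Lemma sphere_area_ge0 p : 0 <= (sphere_area p : R).
Proof.
rewrite divr_ge0 ?mulr_ge0 ?powR_ge0// /Gamma.
by apply: Rintegral_ge0 => t _; rewrite mulr_ge0 ?powR_ge0 ?expR_ge0.
Qed.

Lemma L1normE f : L1norm f = \int[leb]_y `|f y|.
Proof. by rewrite /L1norm Lnorm1. Qed.

Lemma norm_kernel_int_le k f x B : half_space x -> tame k ->
  leb.-integrable setT (EFin \o f) ->
  (forall d, xlast d = xlast x -> `|k d| <= B) ->
  `|kernel_int k f x| <= B * L1norm f.
Proof.
move=> x0 gk intf kB; have intk := integrable_kernel x0 gk intf.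
rewrite (le_trans (le_normr_Rintegral _ _))// L1normE -RintegralZl//; last first.
  exact: integrable_norm.
apply: le_Rintegral => //.
- exact: integrable_norm.
- have := integrableZl measurableT B (integrable_norm intf).
  by apply: eq_integrable.
- by move=> y _; rewrite normrM ler_wpM2r// kB// xlast_sub_boundary.
Qed.

Lemma boundary_point_dist x y y0 delta : 0 < delta -> box y0 delta y ->
  `|(x - boundary_point y) - (x - boundary_point y0)| <= delta.
Proof.
move=> d0 yb; rewrite [leLHS]/Num.Def.normr/= mx_normrE.
apply: bigmax_le => [|[i j] _]; first exact: ltW.
rewrite !mxE/=; case: unliftP => [l _|_].
  by rewrite opprD addrACA subrr add0r opprK addrC distrC ltW// yb.
by rewrite subrr normr0 ltW.
Qed.

(** The indicator of a small box around y0 plays the role of a Dirac mass: the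
    Lipschitz bound keeps k within e of its value at y0 on the box. *)
Lemma kernel_int_concentrated k x y0 e : half_space x -> tame k -> 0 < e ->
  exists f, [/\ leb.-integrable setT (EFin \o f), 0 < L1norm f &
    (k (x - boundary_point y0) - e) * L1norm f <= kernel_int k f x].
Proof.
move=> x0 gk e0; have {}x0 : 0 < xlast x := x0.
have x20 : 0 < xlast x / 2 by rewrite divr_gt0.
have [L [L0 kL]] := tame_lipschitz gk x20.
(* The box is so small that k varies by at most L * delta <= e on it. *)
pose delta := e / (L + 1).
have L10 : 0 < L + 1 by rewrite ltr_wpDl.
have d0 : 0 < delta by rewrite divr_gt0.
pose A := box y0 delta.
have mA : measurable A by exact: measurable_box.
have [A0 Aoo] : (0 < leb A /\ leb A < +oo)%E.
  exact/andP/lebesgue_tuple_box.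
have intA : leb.-integrable setT (EFin \o (\1_A : Y -> R)).
  apply/integrableP; split; first exact/measurable_EFinP.
  under eq_integral => y _ do rewrite /= ger0_norm//.
  by rewrite integral_indic// setIT.
have normA : L1norm (\1_A : Y -> R) = \int[leb]_y (\1_A y).
  rewrite L1normE; apply: eq_Rintegral => y _; rewrite ger0_norm//.
have intE : \int[leb]_y (\1_A y) = fine (leb A).
  by rewrite /Rintegral integral_indic// setIT.
exists \1_A; split => //.
  by rewrite normA intE fine_gt0// A0 Aoo.
rewrite normA -RintegralZl//; apply: le_Rintegral => //.
- have := integrableZl measurableT (k (x - boundary_point y0) - e) intA.
  by apply: eq_integrable.
- exact: integrable_kernel.
- move=> y _; rewrite indicE; have [yA|] := boolP (y \in A); last by rewrite !mulr0.
  rewrite !mulr1 lerBlDr -lerBlDl.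
  rewrite (le_trans (ler_norm _))// (le_trans (kL _ _ _ _))//;
    rewrite ?xlast_sub_boundary; try lra.
  rewrite distrC.
  rewrite (@le_trans _ _ (L * delta))// ?ler_wpM2l ?boundary_point_dist//.
    by move: yA; rewrite inE.
  by rewrite /delta mulrCA ler_piMr ?(ltW e0)// ler_pdivrMr// mul1r lerDl.
Qed.

Lemma sum_partial_weighted alpha v f x w : half_space x -> hardy1 v f ->
  \sum_i w i * partial i (weighted alpha v) x =
  2 * n / omega * xlast x `^ (n * alpha - 1) *
    kernel_int (fun d => \sum_i w i * gradient_kernel alpha i d) f x.
Proof.
move=> x0 vf; have [_ intf _] := vf.
have gw i : tame (fun d => w i * gradient_kernel alpha i d).
  exact: tameM (tame_cst _) (tame_gradient_kernel _ _).
rewrite (kernel_int_sum _ x0 gw intf) mulr_sumr; apply: eq_bigr => i _.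
rewrite (partial_weighted _ _ x0 vf) kernel_intZ//; last exact: tame_gradient_kernel.
by rewrite mulrCA.
Qed.

Lemma tame_sum_gradient_kernel alpha w :
  tame (fun d => \sum_i w i * gradient_kernel alpha i d).
Proof.
elim: (index_enum _) => [|j s IH].
  by under eq_fun do rewrite big_nil; exact: tame_cst.
under eq_fun do rewrite big_cons.
exact: tameD (tameM (tame_cst _) (tame_gradient_kernel _ _)) IH.
Qed.

Lemma sum_partial_weighted_le alpha v f x w B : half_space x -> hardy1 v f ->
  (forall d, xlast d = xlast x ->
     `|\sum_i w i * gradient_kernel alpha i d| <= B) ->
  `|\sum_i w i * partial i (weighted alpha v) x| <=
  2 * n / omega * xlast x `^ (n * alpha - 1) * B * L1norm f.
Proof.
move=> x0 vf kB; have [_ intf _] := vf.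
rewrite (sum_partial_weighted _ _ x0 vf) normrM.
have A0 : 0 <= 2 * n / omega * xlast x `^ (n * alpha - 1).
  by rewrite mulr_ge0 ?powR_ge0// divr_ge0 ?sphere_area_ge0// mulr_ge0.
rewrite (ger0_norm A0) -[leRHS]mulrA ler_wpM2l//.
exact: norm_kernel_int_le (tame_sum_gradient_kernel _ _) intf kB.
Qed.

(** Tested on Poisson integrals of functions concentrated near a boundary point,
    a valid constant has to dominate the integrand at that point. *)
Lemma sharp_lower_bound alpha x y0 w c (F : (V -> R) -> R) : half_space x ->
  (forall v, \sum_i w i * partial i (weighted alpha v) x <= F v) ->
  (forall v f, hardy1 v f -> F v <= c * L1norm f) ->
  2 * n / omega * xlast x `^ (n * alpha - 1) *
    \sum_i w i * gradient_kernel alpha i (x - boundary_point y0) <= c.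
Proof.
move=> x0 wF Fc.
set A := 2 * n / omega * xlast x `^ (n * alpha - 1).
have A0 : 0 <= A.
  by rewrite mulr_ge0 ?powR_ge0// divr_ge0 ?sphere_area_ge0// mulr_ge0.
apply/ler_addgt0Pr => e e0.
have A10 : 0 < A + 1 by rewrite ltr_wpDl.
have [f [intf f0 fk]] := kernel_int_concentrated y0 x0
  (tame_sum_gradient_kernel alpha w) (divr_gt0 e0 A10).
have vf := hardy1_poisson intf.
have := le_trans (wF _) (Fc _ _ vf).
rewrite (sum_partial_weighted _ _ x0 vf) -/A.
move=> /(le_trans (ler_wpM2l A0 fk)); rewrite mulrA ler_pM2r// mulrBr.
rewrite lerBlDr => /le_trans; apply; rewrite lerD2l mulrCA ler_piMr ?(ltW e0)//.
by rewrite ler_pdivrMr// mul1r lerDl.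
Qed.
End gradient_bounds.

(** * Maximization of the profile *)

Section profile.
Context {R : realType}.
Implicit Types (alpha s t a b : R) (p : nat).

Definition profile p alpha t : R := t ^+ p * (alpha ^+ 2 - (2 * alpha - 1) * t).

(** The two values are those of the profile at its critical point, when it lies
    in (0, 1), and at t = 1. *)
Definition profile_max p alpha : R :=
  if p%:R * alpha ^+ 2 < (p%:R + 1) * (2 * alpha - 1) then
    (p%:R / (2 * alpha - 1)) ^+ p * (alpha ^+ 2 / (p%:R + 1)) ^+ p.+1
  else (1 - alpha) ^+ 2.

(** Bernoulli's inequality for 1/s, multiplied out: the profile in the variable
    s = t / (critical point), normalized to have maximum 1. *)
Lemma unimodal_bound p s : 0 <= s -> s ^+ p * (p%:R + 1 - p%:R * s) <= 1.
Proof.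
move=> s0; elim: p => [|p IH]; first by rewrite expr0; lra.
have sp : 0 <= (s ^+ p.+1 - 1) * (s - 1).
  have [s1|s1] := leP 1 s.
    by rewrite mulr_ge0 ?subr_ge0// exprn_ege1.
  by rewrite mulr_le0 ?subr_le0 ?(ltW s1)// exprn_ile1// ltW.
have := ler_wpM2l s0 IH; rewrite mulrA -exprS mulr1 -natr1.
move: sp; set u := s ^+ p.+1; set q : R := p%:R => sp h; nra.
Qed.

Lemma exprMSr p a b : a ^+ p * b ^+ p.+1 = (a * b) ^+ p * b.
Proof. by rewrite exprMn exprSr mulrA. Qed.

(** If 2 alpha > 1 and the critical point is at least 1, alpha^2 is
    (p + 1)/p (2 alpha - 1) plus a nonnegative remainder: the first part gives a
    profile with maximum at t = 1, and the remainder multiplies t^p <= 1. *)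
Lemma profile_le p alpha t : 0 < t <= 1 -> (0 < p)%N ->
  profile p alpha t <= profile_max p alpha.
Proof.
move=> /andP[t0 t1] p0; rewrite /profile /profile_max.
have pr0 : 0 < p%:R :> R by rewrite ltr0n.
have p1 : 0 < p%:R + 1 :> R by rewrite ltr_wpDl.
have tp0 : 0 < t ^+ p by rewrite exprn_gt0.
have tp1 : t ^+ p <= 1 by rewrite exprn_ile1// ltW.
case: ltP => [c|c].
  have b0 : 0 < 2 * alpha - 1 by nra.
  have a0 : 0 < alpha by lra.
  pose s := t / (p%:R * alpha ^+ 2 / ((p%:R + 1) * (2 * alpha - 1))).
  have s0 : 0 <= s.
    by rewrite !(divr_ge0, mulr_ge0, exprn_ge0) ?(ltW a0) ?(ltW b0) ?(ltW t0)
      ?(ltW pr0)// addr_ge0.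
  have -> : t = s * (p%:R / (2 * alpha - 1) * (alpha ^+ 2 / (p%:R + 1))).
    by rewrite /s; field; rewrite !gt_eqF.
  rewrite [leRHS](_ : _ = (p%:R / (2 * alpha - 1) * (alpha ^+ 2 / (p%:R + 1))) ^+ p *
     (alpha ^+ 2 / (p%:R + 1))); last exact: exprMSr.
  have c0 : 0 <= alpha ^+ 2 / (p%:R + 1) by rewrite divr_ge0 ?sqr_ge0 ?(ltW p1).
  set q := p%:R / _ * _.
  have q0 : 0 <= q by rewrite mulr_ge0// divr_ge0// ltW.
  rewrite [leLHS](_ : _ = (q ^+ p * (alpha ^+ 2 / (p%:R + 1))) *
     (s ^+ p * (p%:R + 1 - p%:R * s))).
    by rewrite ler_piMr ?unimodal_bound// mulr_ge0 ?exprn_ge0.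
  by rewrite exprMn /q; field; rewrite !gt_eqF.
have [b0|b0] := leP (2 * alpha - 1) 0.
  have bt : 0 <= (2 * alpha - 1) * (t - 1) by rewrite mulr_le0// subr_le0.
  have bt' : 0 <= - ((2 * alpha - 1) * t) by rewrite oppr_ge0 mulr_le0_ge0// ltW.
  apply: (@le_trans _ _ (alpha ^+ 2 - (2 * alpha - 1) * t)).
    by rewrite ler_piMl// addr_ge0// sqr_ge0.
  by nra.
have := unimodal_bound p (ltW t0) => h.
have e0 : 0 <= alpha ^+ 2 - (p%:R + 1) / p%:R * (2 * alpha - 1).
  rewrite subr_ge0 mulrAC ler_pdivrMr// [leRHS]mulrC//.
rewrite [leLHS](_ : _ = t ^+ p * (alpha ^+ 2 - (p%:R + 1) / p%:R * (2 * alpha - 1))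
   + (2 * alpha - 1) / p%:R * (t ^+ p * (p%:R + 1 - p%:R * t))); last first.
  by field; rewrite gt_eqF.
rewrite [leRHS](_ : _ = 1 * (alpha ^+ 2 - (p%:R + 1) / p%:R * (2 * alpha - 1))
   + (2 * alpha - 1) / p%:R * 1); last first.
  by field; rewrite gt_eqF.
by rewrite lerD// ?ler_wpM2r// ler_wpM2l// divr_ge0 ?(ltW b0) ?(ltW pr0).
Qed.

Lemma profile_attained p alpha : (0 < p)%N ->
  exists2 t, 0 < t <= 1 & profile p alpha t = profile_max p alpha.
Proof.
move=> p0; rewrite /profile /profile_max.
have pr0 : 0 < p%:R :> R by rewrite ltr0n.
have p1 : 0 < p%:R + 1 :> R by rewrite ltr_wpDl.
case: ltP => [c|c]; last first.
  by exists 1; [rewrite ltr01 lexx|rewrite expr1n; ring].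
have b0 : 0 < 2 * alpha - 1 by nra.
have a0 : 0 < alpha by lra.
exists (p%:R / (2 * alpha - 1) * (alpha ^+ 2 / (p%:R + 1))).
  rewrite !(divr_gt0, mulr_gt0, exprn_gt0)// //=.
  rewrite mulf_div ler_pdivrMr ?mul1r; first by rewrite [leRHS]mulrC ltW.
  by rewrite mulr_gt0.
rewrite exprMSr; congr (_ * _).
by field; rewrite !gt_eqF.
Qed.

Lemma profile_max_out p alpha :
  (p%:R + 1) * (2 * alpha - 1) <= p%:R * alpha ^+ 2 ->
  profile_max p alpha = (1 - alpha) ^+ 2.
Proof. by move=> c; rewrite /profile_max ltNge c. Qed.

(** The formula extends to the boundary case, where the critical point is 1 and
    both values agree. *)
Lemma profile_max_in p alpha : (0 < p)%N ->
  p%:R * alpha ^+ 2 <= (p%:R + 1) * (2 * alpha - 1) ->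
  profile_max p alpha =
  (p%:R / (2 * alpha - 1)) ^+ p * (alpha ^+ 2 / (p%:R + 1)) ^+ p.+1.
Proof.
move=> p0; rewrite /profile_max le_eqVlt => /predU1P[c|->//].
have pr0 : 0 < p%:R :> R by rewrite ltr0n.
have p1 : 0 < p%:R + 1 :> R by rewrite ltr_wpDl.
rewrite c ltxx; have [a0|a0] := eqVneq alpha 0.
  by move: c; rewrite a0; nra.
have a20 : 0 < alpha ^+ 2 by rewrite exprn_even_gt0.
have b0 : 0 < 2 * alpha - 1 by nra.
rewrite (_ : _ / (2 * alpha - 1) = (alpha ^+ 2 / (p%:R + 1))^-1).
  rewrite exprMSr mulVf ?expr1n ?mul1r; last first.
    by rewrite gt_eqF// divr_gt0.
  apply: (mulIf (lt0r_neq0 p1)); rewrite divfK ?gt_eqF//.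
  by nra.
apply: (mulIf (lt0r_neq0 a20)); apply: (mulIf (lt0r_neq0 b0)).
rewrite invf_div mulfVK ?gt_eqF// mulrAC divfK ?gt_eqF//.
Qed.

Lemma powR_half p a : 0 <= a -> a `^ (p%:R / 2) = Num.sqrt (a ^+ p).
Proof.
by move=> a0; rewrite powRrM powR12_sqrt ?powR_ge0// powR_mulrn.
Qed.

End profile.

(** * Sharp coefficients *)

Section sharpness.
Context {R : realType} {m : nat}.
Local Notation V := 'rV[R]_m.+1.
Local Notation Y := (m.-tuple (measurableTypeR R)).
Local Notation n := (m.+1%:R : R).
Local Notation omega := (sphere_area m.+1 : R).
Implicit Types (d x u : V) (y : Y) (w : 'I_m.+1 -> R) (alpha : R).

(** Expand the square of u - s w with s = <w, u>. *)
Lemma cauchy_schwarz_unit u w : \sum_i w i ^+ 2 <= 1 ->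
  `|\sum_i w i * u 0 i| <= enorm u.
Proof.
move=> w1; rewrite -ler_sqr ?nnegrE ?enorm_ge0// enorm_sqr real_normK ?num_real//.
have E (s : R) : \sum_i (u 0 i - s * w i) ^+ 2 =
    \sum_i u 0 i ^+ 2 - 2 * s * (\sum_i w i * u 0 i) + s ^+ 2 * \sum_i w i ^+ 2.
  rewrite !mulr_sumr -sumrB -big_split/=.
  by apply: eq_bigr => i _; ring.
set s := \sum_i w i * u 0 i.
have : 0 <= \sum_i (u 0 i - s * w i) ^+ 2.
  by apply: sumr_ge0 => i _; rewrite sqr_ge0.
by rewrite E -/s; have := ler_wpM2l (sqr_ge0 s) w1; rewrite mulr1; nra.
Qed.

(** The zero vector is the reason for asking w to have length at most 1. *)
Lemma enorm_dual u : exists w, \sum_i w i ^+ 2 <= 1 /\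
  \sum_i w i * u 0 i = enorm u.
Proof.
exists (fun i => u 0 i / enorm u).
have [u0|u0] := eqVneq (enorm u) 0.
  by rewrite u0; split; rewrite big1// => i _; rewrite invr0 mulr0 ?mul0r// expr0n.
split.
  under eq_bigr do rewrite exprMn.
  by rewrite -mulr_suml -enorm_sqr -exprMn divff// expr1n.
under eq_bigr do rewrite mulrAC -expr2.
by rewrite -mulr_suml -enorm_sqr expr2 mulfK.
Qed.

(** In terms of the cosine c = d_n/|d| one has |d|^(-n) = c^n / d_n^n, and
    |alpha e_n - c d/|d||^2 = alpha^2 - 2 alpha c^2 + c^2. *)
Lemma enorm_gradient_kernel alpha d : half_space d ->
  enorm (\row_i gradient_kernel alpha i d) =
  xlast d ^- m.+1 * Num.sqrt (profile m.+1 alpha (dircos ord_max d ^+ 2)).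
Proof.
move=> d0; have d0' : 0 < xlast d := d0.
have rE : rho d = dircos ord_max d / xlast d.
  by rewrite /dircos mulrC -/(xlast d) mulKf ?gt_eqF.
rewrite -[X in X * _](@ger0_norm _ (xlast d ^- m.+1)) ?invr_ge0 ?exprn_ge0 ?ltW//.
rewrite -sqrtr_sqr -sqrtrM ?sqr_ge0//; congr Num.sqrt.
set c := dircos ord_max d in rE *.
transitivity (rho d ^+ m.+1 ^+ 2 * (alpha ^+ 2 - (2 * alpha - 1) * c ^+ 2)).
  under eq_bigr do rewrite mxE exprMn.
  rewrite -mulr_sumr; congr (_ * _).
  rewrite (eq_bigr (fun i => (ord_max == i)%:R *
      (alpha ^+ 2 - 2 * alpha * c * dircos i d) + c ^+ 2 * dircos i d ^+ 2)).
    rewrite big_split/= -mulr_sumr sum_sqr_dircos// (bigD1 ord_max)//= eqxx.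
    rewrite big1 => [|i /negbTE]; last by rewrite eq_sym => ->; rewrite mul0r.
    by rewrite -/c mul1r; ring.
  by move=> i _; rewrite -/c; case: (_ == _) => /=; ring.
rewrite rE /profile [RHS]mulrA; congr (_ * _).
by rewrite [in LHS]exprMn exprVn [LHS]exprMn [LHS]mulrC -!exprM mulnC.
Qed.

Definition sharp_constant alpha : R :=
  2 * n / omega * Num.sqrt (profile_max m.+1 alpha).

Lemma sharp_constantE alpha x : half_space x ->
  sharp_constant alpha * xlast x `^ (n * (alpha - 1) - 1) =
  2 * n / omega * xlast x `^ (n * alpha - 1) *
    (xlast x ^- m.+1 * Num.sqrt (profile_max m.+1 alpha)).
Proof.
move=> x0; have x0' : 0 < xlast x := x0.
have -> : n * (alpha - 1) - 1 = (n * alpha - 1) - n by ring.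
rewrite powRB ?(gt_eqF x0') ?implybT// powR_mulrn ?(ltW x0')// /sharp_constant.
by ring.
Qed.

Lemma gradient_kernel_le alpha d w : half_space d -> \sum_i w i ^+ 2 <= 1 ->
  `|\sum_i w i * gradient_kernel alpha i d| <=
  xlast d ^- m.+1 * Num.sqrt (profile_max m.+1 alpha).
Proof.
move=> d0 w1; have := cauchy_schwarz_unit (\row_i gradient_kernel alpha i d) w1.
under eq_bigr do rewrite mxE.
move=> /le_trans; apply; rewrite enorm_gradient_kernel// ler_wpM2l//.
  by rewrite invr_ge0 exprn_ge0// ltW.
apply: ler_wsqrtr; apply: profile_le => //.
have c0 : 0 < dircos ord_max d by rewrite mulr_gt0// invr_gt0 enorm_gt0.
rewrite exprn_gt0//= expr_le1// ?(ltW c0)//.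
by have := dircos_le1 ord_max d; rewrite ger0_norm// ltW.
Qed.

Lemma sum_partial_weighted_sharp alpha v f x w : half_space x -> hardy1 v f ->
  \sum_i w i ^+ 2 <= 1 ->
  `|\sum_i w i * partial i (weighted alpha v) x| <=
  sharp_constant alpha * xlast x `^ (n * (alpha - 1) - 1) * L1norm f.
Proof.
move=> x0 vf w1; rewrite sharp_constantE//.
apply: sum_partial_weighted_le => // d dx.
have d0 : half_space d by rewrite /half_space/= dx.
by rewrite -dx; exact: gradient_kernel_le.
Qed.

Lemma sum_delta (k : 'I_m.+1 -> R) (s : R) (i : 'I_m.+1) :
  \sum_j (s * (i == j)%:R) * k j = s * k i.
Proof.
rewrite (bigD1 i)//= eqxx mulr1 big1 ?addr0// => j /negbTE.
by rewrite eq_sym => ->; rewrite mulr0 mul0r.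
Qed.

Lemma boundary_point_below x :
  {y | x - boundary_point y = \row_i ((ord_max == i)%:R * xlast x)}.
Proof.
exists [tuple x 0 (lift ord_max j) | j < m].
apply/rowP => i; rewrite !mxE; case: unliftP => [j ->|->].
  by rewrite tnth_mktuple subrr (negbTE (neq_lift _ _)) mul0r.
by rewrite subr0 eqxx mul1r.
Qed.

(** Moving sideways from the foot of the perpendicular by x_n sqrt(1/t - 1)
    makes |x - y|^2 = x_n^2 / t. *)
Lemma boundary_point_direction x t : (1 < m)%N -> half_space x -> 0 < t <= 1 ->
  exists y, dircos ord_max (x - boundary_point y) ^+ 2 = t.
Proof.
move=> m1 x0 /andP[t0 t1]; have x0' : 0 < xlast x := x0.
have m0 : (0 < m)%N by exact: ltnW.
pose j0 := Ordinal m0.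
pose s := xlast x * Num.sqrt (t^-1 - 1).
exists [tuple x 0 (lift ord_max j) - (j == j0)%:R * s | j < m].
set d := x - _.
have dE i : d 0 i = if unlift ord_max i is Some j then (j == j0)%:R * s else xlast x.
  rewrite !mxE; case: unliftP => [j ->|->]; last by rewrite subr0.
  by rewrite tnth_mktuple opprB addrC subrK.
have dn : d 0 ord_max = xlast x by rewrite dE unlift_none.
have qE : enorm d ^+ 2 = xlast x ^+ 2 / t.
  rewrite enorm_sqr (bigD1 ord_max)//= dn (bigD1 (lift ord_max j0))/=; last first.
    by rewrite eq_sym neq_lift.
  rewrite dE liftK eqxx mul1r big1 ?addr0 => [|i /andP[im ij]].
    rewrite exprMn sqr_sqrtr; last by rewrite subr_ge0 invf_ge1.
    by rewrite -[X in X + _]mulr1 -mulrDr subrKC.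
  rewrite dE; case: unliftP im ij => [j ->|->]; last by rewrite eqxx.
  move=> _; rewrite (inj_eq (@lift_inj _ _)) => /negbTE ->.
  by rewrite mul0r expr0n.
rewrite /dircos /rho exprMn exprVn qE dn invf_div mulrCA divff ?mulr1//.
by rewrite expf_neq0// gt_eqF.
Qed.

Lemma grad_sharp alpha x : (1 < m)%N -> half_space x ->
  sharp_coefficient (fun v => enorm (grad (weighted alpha v) x))
    (sharp_constant alpha * xlast x `^ (n * (alpha - 1) - 1)).
Proof.
move=> m1 x0; split=> [v f vf|c valid_c].
  have [w [w1 <-]] := enorm_dual (grad (weighted alpha v) x).
  under eq_bigr do rewrite mxE.
  exact: le_trans (ler_norm _) (sum_partial_weighted_sharp _ x0 vf w1).
have [t t01 tE] := profile_attained alpha (ltn0Sn m).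
have [y yE] := boundary_point_direction m1 x0 t01.
have [w [w1 wE]] := enorm_dual (\row_i gradient_kernel alpha i (x - boundary_point y)).
have d0 := half_space_sub_boundary y x0.
rewrite sharp_constantE// -tE -yE -(xlast_sub_boundary x y).
rewrite -enorm_gradient_kernel// -wE xlast_sub_boundary.
under eq_bigr do rewrite mxE.
apply: sharp_lower_bound valid_c => // v.
apply: le_trans (cauchy_schwarz_unit (grad (weighted alpha v) x) w1).
by under [in leRHS]eq_bigr do rewrite mxE; exact: ler_norm.
Qed.

(** The maximum of the profile is at t = 1, that is at the foot of the
    perpendicular from x, where the kernel is vertical; the vertical test vector
    with the sign of alpha - 1 attains it. *)
Lemma partial_last_sharp alpha x : half_space x ->
  (m.+1%:R + 1) * (2 * alpha - 1) <= m.+1%:R * alpha ^+ 2 ->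
  sharp_coefficient (fun v => `|partial ord_max (weighted alpha v) x|)
    (sharp_constant alpha * xlast x `^ (n * (alpha - 1) - 1)).
Proof.
move=> x0 out; have x0' : 0 < xlast x := x0.
split=> [v f vf|c valid_c].
  rewrite -[X in `|X|]mul1r -(sum_delta (fun i => partial i (weighted alpha v) x)).
  apply: sum_partial_weighted_sharp => //.
  rewrite (bigD1 ord_max)//= eqxx big1 ?addr0 ?mulr1 ?expr1n// => i /negbTE.
  by rewrite eq_sym => ->; rewrite mulr0 expr0n.
have [y yE] := boundary_point_below x.
rewrite sharp_constantE// profile_max_out// sqrtr_sqr.
pose s := Num.sg (alpha - 1).
rewrite (_ : _ ^- _ * _ = \sum_i s * (ord_max == i)%:R *
    gradient_kernel alpha i (x - boundary_point y)); last first.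
  rewrite sum_delta /gradient_kernel eqxx.
  have rE : rho (x - boundary_point y) = (xlast x)^-1.
    rewrite /rho; congr (_^-1); rewrite yE /enorm (bigD1 ord_max)//= big1 => [|i /negbTE].
      by rewrite mxE eqxx mul1r addr0 sqrtr_sqr gtr0_norm.
    by rewrite mxE eq_sym => ->; rewrite mul0r expr0n.
  have cE : dircos ord_max (x - boundary_point y) = 1.
    by rewrite /dircos rE yE mxE eqxx mul1r divff// gt_eqF.
  rewrite rE cE !mulr1 exprVn mulrCA; congr (_ * _).
  by rewrite distrC normrEsg.
apply: sharp_lower_bound valid_c => // v.
rewrite sum_delta (le_trans (ler_norm _))// normrM ler_piMl//.
by rewrite normr_sg; case: (_ != _).
Qed.

End sharpness.

(** * The range of alpha *)

Section thresholds.
Context {R : realType}.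
Implicit Types (alpha s N : R).

(** The condition that decides between the two formulas changes sign exactly
    at s/(s + 1) and s/(s - 1), where s = sqrt(n + 1). *)
Lemma threshold_factor alpha s N : s ^+ 2 = N + 1 ->
  (N + 1) * (2 * alpha - 1) - N * alpha ^+ 2 =
  (alpha * (s + 1) - s) * (s - alpha * (s - 1)).
Proof. by move=> sN; have -> : N = s ^+ 2 - 1; [rewrite sN addrK|ring]. Qed.

(** For alpha = (n - 1)/n: it lies in the middle range as soon as n >= 3, but is
    its lower end for n = 3, hence the weak inequality. *)
Lemma pred_ratio_identities N : 2 < N -> let alpha := (N - 1) / N in
  let K := (N - 1) ^+ 2 / ((N - 2) * (N + 1)) in
  [/\ 3 <= N -> N * alpha ^+ 2 <= (N + 1) * (2 * alpha - 1),
      N / (2 * alpha - 1) * (alpha ^+ 2 / (N + 1)) = K &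
      alpha ^+ 2 / (N + 1) = K * ((N - 2) / N ^+ 2)].
Proof.
move=> N2 alpha K.
have N0 : 0 < N by lra.
have N1 : 0 < N + 1 by lra.
have {}N2 : 0 < N - 2 by lra.
have aE : 2 * alpha - 1 = (N - 2) / N by rewrite /alpha; field; rewrite gt_eqF.
rewrite aE /alpha /K; split.
- move=> N3; rewrite (_ : N * _ = (N - 1) ^+ 2 / N); last by field; rewrite gt_eqF.
  by rewrite mulrA ler_pM2r ?invr_gt0//; nra.
- by field; rewrite !gt_eqF.
- by field; rewrite !gt_eqF.
Qed.

End thresholds.

(* The source prints (n + 2)/2 for the exponent of alpha^2/(n + 1) and, as
   C_(1,n,1), the expression obtained at alpha = (n - 1)/n. Both are misprints:
   with c = x_n/|y - x| and t = c^2, the gradient of x_n^(n alpha)/|y - x|^n has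
   squared norm n^2 x_n^(2(n(alpha - 1) - 1)) t^n (alpha^2 - (2 alpha - 1) t),
   whose supremum over 0 < t <= 1 gives the exponent (n + 1)/2 used below. *)
Theorem corollary2 (R : realType) (m : nat) (hn : (2 < m.+1)%N) :
  let n : R := m.+1%:R in
  let omega : R := sphere_area m.+1 in
  let lo : R := Num.sqrt (n + 1) / (Num.sqrt (n + 1) + 1) in
  let hi : R := Num.sqrt (n + 1) / (Num.sqrt (n + 1) - 1) in
  exists C : R -> R,
  [/\ (forall (alpha : R) (x : 'rV[R]_m.+1), 0 <= alpha -> half_space x ->
         sharp_coefficient (fun v => enorm (grad (weighted alpha v) x))
           (C alpha * xlast x `^ (n * (alpha - 1) - 1))),
      (forall alpha : R, 0 <= alpha <= lo \/ hi <= alpha ->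
         C alpha = 2 * n / omega * `|1 - alpha|),
      (forall alpha : R, lo < alpha < hi ->
         C alpha = 2 * n / omega * (n / (2 * alpha - 1)) `^ (n / 2)
                   * (alpha ^+ 2 / (n + 1)) `^ ((n + 1) / 2)),
      (C 1 = 2 * n / omega * n `^ (n / 2) / (n + 1) `^ ((n + 1) / 2) /\
       C ((n - 1) / n) = 2 * Num.sqrt (n - 2) / omega
         * ((n - 1) ^+ 2 / ((n - 2) * (n + 1))) `^ ((n + 1) / 2)) &
      (forall (alpha : R) (x : 'rV[R]_m.+1),
         0 <= alpha <= lo \/ hi <= alpha -> half_space x ->
         sharp_coefficient (fun v => `|partial ord_max (weighted alpha v) x|)
           (C alpha * xlast x `^ (n * (alpha - 1) - 1)))].
Proof.
move=> n omega lo hi.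
have n3 : 3 <= n by rewrite ler_nat.
have s2 : Num.sqrt (n + 1) ^+ 2 = n + 1 by rewrite sqr_sqrtr//; lra.
have s1 : 1 < Num.sqrt (n + 1).
  by rewrite -[ltLHS]sqrtr1 ltr_sqrt; lra.
have out alpha : 0 <= alpha <= lo \/ hi <= alpha ->
    (n + 1) * (2 * alpha - 1) <= n * alpha ^+ 2.
  move=> h; rewrite -subr_le0 (threshold_factor _ s2).
  move: h; rewrite /lo /hi; set s := Num.sqrt _ in s1 *.
  rewrite ler_pdivlMr ?ler_pdivrMr; [|lra..].
  move=> [/andP[a0 h]|h]; last by rewrite mulr_ge0_le0//; nra.
  by rewrite mulr_le0_ge0//; nra.
have inn alpha : lo < alpha < hi -> n * alpha ^+ 2 <= (n + 1) * (2 * alpha - 1).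
  rewrite -subr_ge0 (threshold_factor _ s2) /lo /hi; set s := Num.sqrt _ in s1 *.
  rewrite ltr_pdivlMr ?ltr_pdivrMr; [|lra..].
  by move=> /andP[h1 h2]; rewrite mulr_ge0//; lra.
exists (@sharp_constant R m); split.
- by move=> alpha x _; exact: grad_sharp.
- move=> alpha /out h; rewrite /sharp_constant profile_max_out//.
  by rewrite sqrtr_sqr.
- move=> alpha /inn h; rewrite /sharp_constant profile_max_in//.
  have b0 : 0 < 2 * alpha - 1 by nra.
  rewrite sqrtrM ?exprn_ge0//; last by rewrite divr_ge0// ?ltW//; lra.
  rewrite powR_half; last by rewrite divr_ge0// ltW.
  rewrite natr1 powR_half; last by rewrite divr_ge0// sqr_ge0.
  by rewrite mulrA.
- split.
    rewrite /sharp_constant profile_max_in//; last by lra.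
    rewrite !expr1n natr1 !powR_half// (_ : 2 * 1 - 1 = 1); last by ring.
    rewrite divr1 sqrtrM ?exprn_ge0// div1r exprVn sqrtrV ?exprn_ge0//.
    by rewrite mulrA.
  have n2 : 2 < n by lra.
  have [/(_ n3) inn1 KE bE] := pred_ratio_identities n2.
  have {}n2 : 0 < n - 2 by lra.
  have n0 : 0 < n by lra.
  rewrite /sharp_constant profile_max_in// -/n -/omega exprMSr KE bE.
  set K := (n - 1) ^+ 2 / _.
  have K0 : 0 <= K.
    by rewrite divr_ge0 ?sqr_ge0// mulr_ge0// ltW//; lra.
  rewrite (_ : (n + 1) / 2 = m.+2%:R / 2) ?powR_half//; last by rewrite natr1.
  rewrite mulrA -exprSr (sqrtrM _ (exprn_ge0 m.+2 K0)) (sqrtrM _ (ltW n2)).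
  rewrite sqrtrV ?sqr_ge0// sqrtr_sqr gtr0_norm//.
  rewrite [LHS](_ : _ = 2 * Num.sqrt (n - 2) / omega * Num.sqrt (K ^+ m.+2) * (n / n)).
    by rewrite divff ?mulr1// gt_eqF.
  by ring.
- by move=> alpha x h x0; apply: partial_last_sharp => //; exact: out.
Qed.
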